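(* Let $A$ be an irreducible non-permutation square matrix with entries in $\{0,1\}$ and let $R>0$ be a real number. Then there exists an irreducible non-permutation square matrix $B$ with entries in $\{0,1\}$ such that the one-sided topological Markov shifts $(X_A,\sigma_A)$ and $(X_B,\sigma_B)$ are continuously orbit equivalent and $h_{\mathrm{top}}(X_B,\sigma_B)>R$.
   Context: A square matrix $A=[A(i,j)]_{i,j=1}^N$ with nonnegative entries is irreducible if for all $i,j$ there is $n\ge 1$ with $A^n(i,j)>0$; non-permutation means it is not a permutation matrix. For an irreducible non-permutation $N\times N$ matrix $A$ with entries in $\{0,1\}$, the one-sided topological Markov shift $(X_A,\sigma_A)$ consists of the space $X_A$ of all sequences $(x_n)_{n\in\mathbb{N}}$ with $x_n\in\{1,\dots,N\}$ and $A(x_n,x_{n+1})=1$ for all $n\in\mathbb{N}$ (with the relative topology of the product topology on $\{1,\dots,N\}^{\mathbb{N}}$), together with the shift $\sigma_A((x_n)_{n\in\mathbb{N}})=(x_{n+1})_{n\in\mathbb{N}}$. Two such shifts $(X_A,\sigma_A)$ and $(X_B,\sigma_B)$ (the sizes of $A$ and $B$ may differ) are continuously orbit equivalent if there exist a homeomorphism $h:X_A\to X_B$ and continuous maps $k_1,l_1:X_A\to\mathbb{Z}_+$, $k_2,l_2:X_B\to\mathbb{Z}_+$, where $\mathbb{Z}_+=\{0,1,2,\dots\}$ is discrete, such that $\sigma_B^{k_1(x)}(h(\sigma_A(x)))=\sigma_B^{l_1(x)}(h(x))$ for all $x\in X_A$ and $\sigma_A^{k_2(y)}(h^{-1}(\sigma_B(y)))=\sigma_A^{l_2(y)}(h^{-1}(y))$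 for all $y\in X_B$. $h_{\mathrm{top}}(X_B,\sigma_B)$ denotes the topological entropy of the continuous map $\sigma_B$ on the compact space $X_B$. *)

(* Defs.v *)
From HB Require Import structures.
From mathcomp Require Import all_boot all_order all_algebra.
From mathcomp Require Import all_classical all_reals all_analysis.
Set Implicit Arguments.
Unset Strict Implicit.
Unset Printing Implicit Defensive.
Import Order.TTheory GRing.Theory Num.Theory.
Import numFieldNormedType.Exports.
Local Open Scope classical_set_scope.
Local Open Scope ring_scope.

Definition zero_one_mx (N : nat) (A : 'M[nat]_N) : Prop :=
  forall i j, A i j = 0%N \/ A i j = 1%N.

Definition irreducible_mx (N : nat) (A : 'M[nat]_N) : Prop :=
  forall i j, exists2 n : nat, (1 <= n)%N & (0 < (A ^+ n) i j)%N.

(* The empty matrix is a permutation matrix, so the last condition forces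
   N to be positive. *)
Definition markov_mx (N : nat) (A : 'M[nat]_N) : Prop :=
  [/\ zero_one_mx A, irreducible_mx A & ~~ is_perm_mx A].

Definition sequences_mx (N : nat) (A : 'M[nat]_N) :
    set {ptws nat -> discrete_topology 'I_N} :=
  [set x | forall n, A (x n) (x n.+1) = 1%N].

(* A set used as a type carries the relative topology. *)
Definition markov_space (N : nat) (A : 'M[nat]_N) : topologicalType :=
  sequences_mx A.

Lemma markov_shift_subproof (N : nat) (A : 'M[nat]_N) (x : markov_space A) :
  (fun n => val x n.+1) \in sequences_mx A.
Proof. by have := valP x; rewrite !inE => Ax n; exact: Ax. Qed.

Definition markov_shift (N : nat) (A : 'M[nat]_N) (x : markov_space A) :
    markov_space A :=
  exist _ (fun n => val x n.+1) (markov_shift_subproof x).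

Definition continuously_orbit_equivalent (N M : nat)
    (A : 'M[nat]_N) (B : 'M[nat]_M) : Prop :=
  exists (h : markov_space A -> markov_space B)
         (g : markov_space B -> markov_space A),
    [/\ continuous h, continuous g, cancel h g & cancel g h] /\
  exists (k1 l1 : markov_space A -> nat) (k2 l2 : markov_space B -> nat),
    [/\ continuous k1, continuous l1, continuous k2 & continuous l2] /\
    (forall x, iter (k1 x) (@markov_shift M B) (h (markov_shift x)) =
               iter (l1 x) (@markov_shift M B) (h x)) /\
    (forall y, iter (k2 y) (@markov_shift N A) (g (markov_shift y)) =
               iter (l2 y) (@markov_shift N A) (g y)).

(* Topological entropy in the sense of Adler, Konheim and McAndrew. *)
Section topological_entropy.
Variables (R : realType) (X : topologicalType).

Definition open_cover (U : set (set X)) : Prop :=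
  (forall V, U V -> open V) /\ \bigcup_(V in U) V = setT.

(* On a compact space, the infimum is a minimum when U is an open cover. *)
Definition subcover_number (U : set (set X)) : R :=
  inf [set n%:R | n in [set n : nat | exists S : set (set X),
    [/\ S `<=` U, (S #= `I_n)%card & \bigcup_(V in S) V = setT]]].

Definition cover_join (U V : set (set X)) : set (set X) :=
  [set P `&` Q | P in U & Q in V].

Definition cover_preimage (f : X -> X) (U : set (set X)) : set (set X) :=
  [set f @^-1` V | V in U].

(* The join of the preimages of U under f^0, ..., f^(n-1). *)
Definition cover_iter (f : X -> X) (U : set (set X)) (n : nat) :
    set (set X) :=
  \big[cover_join/[set setT]]_(i < n) cover_preimage (iter i f) U.

(* On a compact space, for f continuous and U an open cover, the limit exists
   and is finite by subadditivity. *)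
Definition cover_entropy (f : X -> X) (U : set (set X)) : R :=
  limn (fun n : nat => ln (subcover_number (cover_iter f U n)) / n%:R).

Definition topological_entropy (f : X -> X) : \bar R :=
  ereal_sup [set (cover_entropy f U)%:E | U in open_cover].

End topological_entropy.

(* Main.v *)
Require Import Defs.
From mathcomp Require Import all_boot all_order all_algebra.
From mathcomp Require Import perm.
From mathcomp Require Import all_classical all_reals all_analysis.
Set Implicit Arguments.
Unset Strict Implicit.
Unset Printing Implicit Defensive.
Import Order.TTheory GRing.Theory Num.Theory.
Import numFieldNormedType.Exports.
Local Open Scope ring_scope.

(** Write sigma for the shift of X_A. The idea is to keep the space X_A and to
    replace sigma by a faster map f, x |-> sigma^(n(x)) x with n continuous,
    which has the same orbits but a much larger entropy, and then to recognize
    (X_A, f) as a topological Markov shift.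

    Since A is irreducible and not a permutation matrix, some vertex v has an
    edge to the starting point of a periodic ray c, of period p, which never
    visits v (avoiding_periodic_ray). Fix K. If x starts with v followed by i
    turns of c and then by the vertex c_0 again, with i <= K maximal, let
    n(x) = 1 + i p; in all other cases let n(x) = 1. So f runs through up to K
    turns of c in one step, but only when it comes from v.

    A step of f only jumps over vertices of c, and these differ from v, so f
    is sigma at each of them. Hence f(x) is also reached from sigma(x) by
    n(x) - 1 steps of f, and this is what continuous orbit equivalence asks for
    (recoding_orbit_equivalent).

    As n(x) depends on a bounded initial window of x, recording the windows
    of x, f(x), f(f(x)), ... is a conjugacy from (X_A, f) onto the Markov shift
    whose states are the windows and whose transitions are the compatible
    overlaps (codeK, decodeK). Its matrix is irreducible: an orbit of f meets
    every visit to v, and K turns of c after v can be used to aim at any point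
    (acceleration_reaches).

    Finally let q be a path from c_0 to v of length l that meets its endpoints
    only once. The loops v c^i q for 0 <= i <= K can be concatenated freely,
    and f goes around each of them in exactly l + 1 steps, whatever i is
    (leap_loops). So there are at least (K + 1)^m words of length (l + 1) m,
    and the entropy is at least ln (K + 1) / (l + 1) (entropy_lower_bound),
    where l does not depend on K. *)

(** * The topology of one-sided Markov shifts *)

Section MarkovTopology.
Local Open Scope classical_set_scope.
Context {N : nat}.
Implicit Type A : 'M[nat]_N.

Definition coord A (n : nat) (x : markov_space A) : discrete_topology 'I_N :=
  val x n.

Lemma markov_space_eq A (x y : markov_space A) :
  (forall n, coord n x = coord n y) -> x = y.
Proof. by move=> xy; apply/val_inj/funext => n; exact: xy. Qed.

Lemma coord_iter_shift A k n (x : markov_space A) :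
  coord n (iter k (@markov_shift N A) x) = coord (k + n) x.
Proof.
elim: k n => //= k IH n.
by rewrite -[LHS]/(coord n.+1 (iter k (@markov_shift N A) x)) IH addnS.
Qed.

Lemma coord_continuous A n : continuous (@coord A n).
Proof.
have cval : continuous (fun x : markov_space A =>
    val x : {ptws nat -> discrete_topology 'I_N}) by exact: initial_continuous.
have cproj := @proj_continuous nat (fun=> discrete_topology 'I_N) n.
move=> x; exact: (@continuous_comp _ _ _ _ _ x (cval x) (cproj (val x))).
Qed.

(** Finite intersections of the open sets given by single coordinates. *)
Lemma nbhs_cylinder A (x : markov_space A) K :
  nbhs x [set y | forall i, (i < K)%N -> coord i y = coord i x].
Proof.
elim: K => [|K IH]; first exact: filterE.
have cK : nbhs x (@coord A K @^-1` [set coord K x]).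
  exact: (@coord_continuous A K x _ (discrete_set1 _)).
by apply: filterS2 cK IH => y /= yK yi i; rewrite ltnS leq_eqVlt => /predU1P[->|/yi].
Qed.

Lemma locally_constant_continuous A (T : topologicalType)
    (F : markov_space A -> T) K :
  (forall x y, (forall i, (i < K)%N -> coord i y = coord i x) -> F y = F x) ->
  continuous F.
Proof.
move=> FK x; apply: (@cvg_near_cst _ _ _ _ (nbhs x)).
by apply: (filterS _ (nbhs_cylinder x K)) => y; exact: FK.
Qed.

Lemma into_markov_continuous (X : topologicalType) A (F : X -> markov_space A) :
  (forall n, continuous (fun x => coord n (F x))) -> continuous F.
Proof.
move=> cF.
apply: (@continuous_comp_initial _ _ _
  (fun x : markov_space A => val x : {ptws nat -> discrete_topology 'I_N})).
move=> x; apply/cvg_sup => n.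
exact: (@continuous_comp_initial _ _ _
  (fun f : nat -> discrete_topology 'I_N => f n) _ (cF n) x).
Qed.
End MarkovTopology.
Arguments coord {N A} n x.

(** * Recoding a faster map as a Markov shift *)

Section Splice.
Context {T : Type}.
Implicit Types (len : nat -> nat) (u : nat -> nat -> T) (pos : nat * nat).

(** The position (k, i) is the i-th place of the k-th word. Moving such a
    position along, instead of concatenating finite prefixes, avoids any bound
    on the number of words. The value u k i may also be given for i = len k:
    that is the lookahead to the first symbol of the next word. *)
Definition splice_step len pos :=
  if (pos.2.+1 < len pos.1)%N then (pos.1, pos.2.+1) else (pos.1.+1, 0%N).

Definition splice_pos len j := iter j (splice_step len) (0, 0)%N.

Definition splice len u j := u (splice_pos len j).1 (splice_pos len j).2.

Lemma splice_pos_head len j : (j < len 0)%N -> splice_pos len j = (0, j)%N.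
Proof.
elim: j => // j IH lt_j.
by rewrite /splice_pos iterS -/(splice_pos _ _) IH 1?ltnW// /splice_step lt_j.
Qed.

Lemma splice_head len u j : (j < len 0)%N -> splice len u j = u 0%N j.
Proof. by move=> lt_j; rewrite /splice splice_pos_head. Qed.

Lemma splice_pos_behead len j : (0 < len 0)%N ->
  splice_pos len (len 0 + j)%N =
  ((splice_pos (len \o succn) j).1.+1, (splice_pos (len \o succn) j).2).
Proof.
move=> len_gt0; elim: j => [|j IH].
  rewrite addn0 -(prednK len_gt0) /splice_pos iterS -/(splice_pos _ _).
  by rewrite splice_pos_head ?prednK// /splice_step /= prednK// ltnn.
rewrite addnS /splice_pos !iterS -!/(splice_pos _ _) IH /splice_step /=.
by case: ifP.
Qed.

Lemma splice_behead len u j : (0 < len 0)%N ->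
  splice len u (len 0 + j)%N = splice (len \o succn) (u \o succn) j.
Proof. by move=> len_gt0; rewrite /splice splice_pos_behead. Qed.

Lemma splice_rel (e : T -> T -> Prop) len u :
    (forall k, (0 < len k)%N) ->
    (forall k i, (i < len k)%N -> e (u k i) (u k i.+1)) ->
    (forall k, u k (len k) = u k.+1 0%N) ->
  forall j, e (splice len u j) (splice len u j.+1).
Proof.
move=> len_gt0 e_u u_len j.
have lt_pos : ((splice_pos len j).2 < len (splice_pos len j).1)%N.
  elim: j => [|j _]; first exact: len_gt0.
  rewrite /splice_pos iterS -/(splice_pos _ _) /splice_step.
  by case: ifP => //= _; exact: len_gt0.
rewrite /splice (_ : splice_pos len j.+1 = splice_step len (splice_pos len j))//.
case: (splice_pos len j) lt_pos => k i /= lt_i.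
rewrite /splice_step /=; case: ltnP => [_|le_i]; first exact: e_u.
have len_k : len k = i.+1 by apply/eqP; rewrite eqn_leq le_i.
by rewrite /= -u_len len_k; exact: e_u.
Qed.
End Splice.

Definition ray (N : nat) (A : 'M[nat]_N) (x : nat -> 'I_N) :=
  forall n, A (x n) (x n.+1) = 1%N.

Lemma mem_ray (N : nat) (A : 'M[nat]_N) (x : nat -> 'I_N) :
  ray A x -> (x : {ptws nat -> discrete_topology 'I_N}) \in sequences_mx A.
Proof. by move=> Ax; rewrite inE. Qed.

Definition point_of_ray (N : nat) (A : 'M[nat]_N) (x : nat -> 'I_N)
    (Ax : ray A x) : markov_space A :=
  exist _ x (mem_ray Ax).

Lemma ray_coord (N : nat) (A : 'M[nat]_N) (x : markov_space A) :
  ray A (coord^~ x).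
Proof. by have := valP x; rewrite inE. Qed.

Section Recoding.
Context {N : nat} (A : 'M[nat]_N) (P : nat) (jump : (nat -> 'I_N) -> nat).
Hypothesis jump_local : forall x y,
  (forall j, (j <= P)%N -> x j = y j) -> jump x = jump y.
Hypothesis jump_gt0 : forall x, (0 < jump x)%N.
Hypothesis jump_le : forall x, (jump x <= P)%N.

Local Notation X := (markov_space A).
Local Notation shift := (@markov_shift N A).

Definition jump_at (x : X) := jump (coord^~ x).

Definition leap (x : X) := iter (jump_at x) shift x.

Definition window (x : X) : {ffun 'I_P.+1 -> 'I_N} :=
  [ffun i : 'I_P.+1 => coord i x].

Definition is_window w := `[< exists x, window x = w >].

(** Only windows of actual points are states; this is what makes the symbols
    inside a state follow the edges of A, and the recoding irreducible. *)
Definition recoding_state := {w | is_window w}.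

Definition recoding_size := #|{: recoding_state}|.

Definition symbol (s : 'I_recoding_size) (j : nat) : 'I_N :=
  val (enum_val s) (inord j).

Lemma window_proof x : is_window (window x).
Proof. by apply/asboolP; exists x. Qed.

Definition state_of (x : X) : 'I_recoding_size :=
  enum_rank (exist _ (window x) (window_proof x) : recoding_state).

Definition recoding : 'M[nat]_recoding_size :=
  \matrix_(s, t) nat_of_bool
    [forall j : 'I_P.+1, (jump (symbol s) + j <= P)%N ==>
                         (symbol s (jump (symbol s) + j) == symbol t j)].

Lemma state_ofP s : exists x, state_of x = s.
Proof.
have /asboolP[x xs] := valP (enum_val s).
by exists x; rewrite -[s]enum_valK; congr enum_rank; exact: val_inj.
Qed.

Lemma symbol_state_of x j : (j <= P)%N -> symbol (state_of x) j = coord j x.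
Proof.
by move=> lejP; rewrite /symbol /state_of enum_rankK /= ffunE inordK.
Qed.

Lemma state_of_eq x y :
  state_of x = state_of y <-> (forall j, (j <= P)%N -> coord j x = coord j y).
Proof.
split=> [xy j lejP|xy]; first by rewrite -!symbol_state_of// xy.
congr enum_rank; apply: val_inj; apply/ffunP => i /=.
by rewrite !ffunE xy// -ltnS.
Qed.

Lemma jump_state_of x : jump (symbol (state_of x)) = jump_at x.
Proof. by apply: jump_local => j /symbol_state_of. Qed.

Lemma recodingP s t :
  recoding s t = 1%N <-> (forall j, (jump (symbol s) + j <= P)%N ->
                           symbol s (jump (symbol s) + j) = symbol t j).
Proof.
rewrite mxE; split=> [st j lejP|st].
  have /forallP/(_ (inord j)) : [forall j : 'I_P.+1, (jump (symbol s) + j <= P)%N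
      ==> (symbol s (jump (symbol s) + j) == symbol t j)] by case: forallP st.
  rewrite inordK ?lejP/=; first by move/eqP.
  by rewrite ltnS (leq_trans _ lejP)// leq_addl.
rewrite (_ : [forall j, _] = true)//; apply/forallP => j; apply/implyP => /st ->.
exact: eqxx.
Qed.

Lemma recoding_leap x : recoding (state_of x) (state_of (leap x)) = 1%N.
Proof.
apply/recodingP => j; rewrite jump_state_of => lejP.
rewrite !symbol_state_of// ?coord_iter_shift//.
by rewrite (leq_trans _ lejP)// leq_addl.
Qed.

Lemma code_proof x : ray recoding (fun n => state_of (iter n leap x)).
Proof. by move=> n; rewrite iterS recoding_leap. Qed.

Definition code (x : X) : markov_space recoding := point_of_ray (code_proof x).

Local Notation Y := (markov_space recoding).

(** To recover a point from its sequence of windows, keep from each window the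
    symbols that the next leap jumps over, and put these blocks end to end. *)
Definition block_length (y : Y) k := jump (symbol (coord k y)).
Definition block (y : Y) k := symbol (coord k y).
Definition unfolding (y : Y) := splice (block_length y) (block y).

Lemma unfolding_shift y j :
  unfolding y (block_length y 0 + j)%N = unfolding (markov_shift y) j.
Proof. by rewrite /unfolding splice_behead ?jump_gt0. Qed.

Lemma block_overlap y k j : (block_length y k + j <= P)%N ->
  block y k (block_length y k + j) = block y k.+1 j.
Proof. by have /recodingP := ray_coord y k; apply. Qed.

(** A window is longer than its block, and its last symbols agree with the
    blocks of the later windows because consecutive windows overlap. *)
Lemma unfolding_head y j : (j <= P)%N -> unfolding y j = symbol (coord 0 y) j.
Proof.
elim/ltn_ind: j y => j IH y lejP.
have [lt_j|le_j] := ltnP j (block_length y 0).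
  by rewrite /unfolding splice_head.
rewrite -(subnKC le_j) unfolding_shift IH.
- rewrite -[LHS]/(block y 1 (j - block_length y 0)).
  by rewrite -block_overlap subnKC.
- by rewrite ltn_subrL jump_gt0 (leq_trans _ le_j)// jump_gt0.
- by rewrite (leq_trans _ lejP)// leq_subr.
Qed.

Lemma unfolding_ray y : ray A (unfolding y).
Proof.
rewrite /ray; apply: (splice_rel (e := fun a b => A a b = 1%N)) => [k|k i lt_i|k].
- exact: jump_gt0.
- have [x xy] := state_ofP (coord k y).
  have lt_iP : (i < P)%N by exact: leq_trans lt_i (jump_le _).
  rewrite /block -xy (symbol_state_of _ (ltnW lt_iP)) (symbol_state_of _ lt_iP).
  exact: (ray_coord x).
- by rewrite -[X in block y k X]addn0 block_overlap ?addn0 ?jump_le.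
Qed.

Definition decode y : X := point_of_ray (unfolding_ray y).

Lemma coord_decode y j : coord j (decode y) = unfolding y j.
Proof. by []. Qed.

Lemma state_of_decode y : state_of (decode y) = coord 0 y.
Proof.
have [x xy] := state_ofP (coord 0 y).
rewrite -xy; apply/state_of_eq => j lejP.
by rewrite coord_decode unfolding_head// -xy symbol_state_of.
Qed.

Lemma decode_shift y : decode (markov_shift y) = leap (decode y).
Proof.
apply: markov_space_eq => j; rewrite coord_iter_shift !coord_decode.
by rewrite -unfolding_shift /block_length -state_of_decode jump_state_of.
Qed.

Lemma code_leap x : code (leap x) = markov_shift (code x).
Proof.
apply: markov_space_eq => k.
by rewrite -[RHS]/(state_of (iter k.+1 leap x)) iterSr.
Qed.

Lemma decodeK : cancel decode code.
Proof.
move=> y; apply: markov_space_eq => k.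
rewrite -[LHS]/(state_of (iter k leap (decode y))).
have -> : iter k leap (decode y) = decode (iter k (@markov_shift _ _) y).
  by elim: k => //= k ->; rewrite decode_shift.
by rewrite state_of_decode coord_iter_shift addn0.
Qed.

Lemma codeK : cancel code decode.
Proof.
move=> x; apply: markov_space_eq => j; rewrite coord_decode.
elim/ltn_ind: j x => j IH x.
have len0 : block_length (code x) 0 = jump_at x by exact: jump_state_of.
have [lejP|ltPj] := leqP j P.
  by rewrite unfolding_head// symbol_state_of.
have le_j : (jump_at x <= j)%N by rewrite (leq_trans _ (ltnW ltPj))// jump_le.
rewrite -{1}(subnKC le_j) -len0 unfolding_shift -code_leap len0 IH.
  by rewrite coord_iter_shift subnKC.
by rewrite ltn_subrL jump_gt0 (leq_trans _ le_j)// jump_gt0.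
Qed.

(** A leap consumes at most P symbols and looks at P + 1 of them. *)
Lemma leap_agree n x y :
    (forall i, (i < n.+1 * P + P.+1)%N -> coord i y = coord i x) ->
  forall i, (i < n * P + P.+1)%N -> coord i (leap y) = coord i (leap x).
Proof.
move=> xy i lt_i; rewrite /leap (_ : jump_at y = jump_at x); last first.
  by apply: jump_local => j lejP; apply: xy; rewrite ltn_addl.
rewrite !coord_iter_shift xy//.
by rewrite mulSn -addnA (leq_ltn_trans (leq_add (jump_le _) (leqnn i)))// ltn_add2l.
Qed.

Lemma code_continuous : continuous code.
Proof.
apply: into_markov_continuous => n.
apply: (@locally_constant_continuous _ _ _ _ (n * P + P.+1)) => x y xy.
apply/state_of_eq => j lejP; move: (j) (lejP : (j < 0 * P + P.+1)%N).
elim: n x y xy => [//|n IH] x y xy i lt_i.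
by rewrite !iterSr; apply: IH => //; exact: leap_agree.
Qed.

Lemma unfolding_agree y z j :
  (forall i, (i < j.+1)%N -> coord i y = coord i z) ->
  unfolding y j = unfolding z j.
Proof.
elim/ltn_ind: j y z => j IH y z yz.
have len_yz : block_length y 0 = block_length z 0 by rewrite /block_length yz.
have [lt_j|le_j] := ltnP j (block_length y 0).
  by rewrite /unfolding !splice_head -?len_yz// /block yz.
have -> : unfolding z j = unfolding (markov_shift z) (j - block_length y 0).
  by rewrite -unfolding_shift -len_yz subnKC.
rewrite -{1}(subnKC le_j) unfolding_shift.
have lt_jj : (j - block_length y 0 < j)%N.
  by rewrite ltn_subrL jump_gt0 (leq_trans _ le_j)// jump_gt0.
apply: IH => // i lt_i; apply: yz; rewrite ltnS.
exact: leq_trans lt_i lt_jj.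
Qed.

Lemma decode_continuous : continuous decode.
Proof.
apply: into_markov_continuous => j.
apply: (@locally_constant_continuous _ _ _ _ j.+1) => y z yz.
exact: unfolding_agree.
Qed.

(** At a point that the leap of x jumps over, the leap is the shift. So
    jump_at x - 1 leaps lead from shift x to leap x, which gives the cocycles of
    the coding map; for its inverse, a shift in the recoding is by definition
    a number of shifts in X_A. *)
Lemma recoding_orbit_equivalent :
    (forall x j, (0 < j < jump_at x)%N -> jump_at (iter j shift x) = 1%N) ->
  continuously_orbit_equivalent A recoding.
Proof.
move=> jump1; exists code, decode; split.
  split; [exact: code_continuous | exact: decode_continuous | |].
    exact: codeK.
  exact: decodeK.
exists (fun x => (jump_at x).-1), (fun=> 1%N), (fun=> 0%N), (block_length^~ 0%N).
split; [split | split].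
- apply: (@locally_constant_continuous _ _ _ _ P.+1) => x y xy; congr predn.
  by apply: jump_local => j /xy.
- exact: cst_continuous.
- exact: cst_continuous.
- apply: (@locally_constant_continuous _ _ _ _ 1) => x y xy.
  by rewrite /block_length xy.
- move=> x.
  have code_iter k z : iter k (@markov_shift _ _) (code z) = code (iter k leap z).
    by elim: k => //= k ->; rewrite code_leap.
  rewrite !code_iter; congr code; rewrite /= {2}/leap.
  have iter_leap k : (k < jump_at x)%N ->
      iter k leap (shift x) = iter k.+1 shift x.
    elim: k => // k IH lt_k; rewrite iterS IH 1?ltnW// /leap jump1//.
  by rewrite iter_leap prednK// jump_gt0.
- by move=> y; rewrite /= decode_shift /leap -jump_state_of state_of_decode.
Qed.
End Recoding.

(** * Subadditive sequences *)

Section Fekete.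
Local Open Scope classical_set_scope.
Context {R : realType} (u : nat -> R).
Hypothesis u_ge0 : forall n, 0 <= u n.
Hypothesis u_subadditive : forall m n, u (m + n)%N <= u m + u n.

Lemma subadditive_muln q m : u (q * m)%N <= u 0%N + u m *+ q.
Proof.
elim: q => [|q IH]; first by rewrite mul0n mulr0n addr0.
by rewrite mulSn (le_trans (u_subadditive _ _))// mulrS addrCA lerD2l.
Qed.

(** Fekete: the limit is the infimum l. If u m / m is close to l, dividing n by
    m with remainder bounds u n / n by u m / m + C / n, where C depends only on
    m. *)
Lemma subadditive_cvg : cvgn (fun n => u n / n%:R).
Proof.
set E := [set u n / n%:R | n in [set n | (0 < n)%N]].
have E_lb : has_lbound E.
  by exists 0 => _ [n /= n_gt0 <-]; rewrite divr_ge0.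
have E_inf : has_inf E by split=> //; exists (u 1%N / 1%:R); exists 1%N.
apply/cvg_ex; exists (inf E); apply/cvgrPdist_lt => e e_gt0.
have e2_gt0 : 0 < e / 2 by rewrite divr_gt0.
have [_ [m /= m_gt0 <-]] := inf_adherent e2_gt0 E_inf.
set l := inf E => lt_m.
pose C := u 0%N + \sum_(i < m) u i.
have C_ge0 : 0 <= C by rewrite addr_ge0// sumr_ge0.
near=> n.
have n_gt0 : (0 < n)%N by near: n; exists 1%N.
have nR_gt0 : 0 < n%:R :> R by rewrite ltr0n.
have mR_gt0 : 0 < m%:R :> R by rewrite ltr0n.
have le_l : l <= u n / n%:R by apply: ge_inf => //; exists n.
rewrite ler0_norm ?subr_le0// opprB ltrBlDr.
have u_n : u n <= u m / m%:R * n%:R + C.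
  rewrite {1}(divn_eq n m) (le_trans (u_subadditive _ _))//.
  have u_mod : u (n %% m)%N <= \sum_(i < m) u i.
    by rewrite (bigD1 (Ordinal (ltn_pmod n m_gt0)))//= lerDl sumr_ge0.
  rewrite (le_trans (lerD (subadditive_muln _ _) u_mod))//.
  rewrite addrAC addrC lerD2r.
  have -> : u m *+ (n %/ m) = u m / m%:R * (n %/ m * m)%:R.
    by rewrite natrM mulrCA divfK ?gt_eqF// mulr_natl.
  by rewrite ler_wpM2l ?divr_ge0// ler_nat leq_trunc_div.
have C_n : C / n%:R < e / 2.
  rewrite ltr_pdivrMr// mulrC -ltr_pdivrMr//.
  near: n; exact: nbhs_infty_gtr.
have u_n_div : u n / n%:R <= u m / m%:R + C / n%:R.
  by rewrite ler_pdivrMr// mulrDl divfK ?gt_eqF.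
rewrite (le_lt_trans u_n_div)//.
by have := ltrD lt_m C_n; rewrite -addrA -splitr (addrC l).
Unshelve. all: by end_near. Qed.
End Fekete.

(** * Entropy and words *)

Section Entropy.
Local Open Scope classical_set_scope.
Context {M : nat} {B : 'M[nat]_M} (y0 : markov_space B).
Local Notation Y := (markov_space B).
Local Notation shift := (@markov_shift M B).

Definition word n (y : Y) : {ffun 'I_n -> 'I_M} := [ffun i : 'I_n => coord i y].

Definition words n : {set {ffun 'I_n -> 'I_M}} :=
  [set w | `[< exists y, word n y = w >]]%SET.

Lemma word_eq n y z :
  word n y = word n z <-> (forall i, (i < n)%N -> coord i y = coord i z).
Proof.
split=> [/ffunP yz i lt_in|yz]; last by apply/ffunP => i; rewrite !ffunE yz.
by have := yz (Ordinal lt_in); rewrite !ffunE.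
Qed.

Lemma mem_words n y : word n y \in words n.
Proof. by rewrite inE; apply/asboolP; exists y. Qed.

Lemma card_words_gt0 n : (0 < #|words n|)%N.
Proof. by apply/card_gt0P; exists (word n y0); exact: mem_words. Qed.

(** A word of length m + n is determined by its first m and its last n
    symbols. *)
Lemma card_wordsD m n : (#|words (m + n)| <= #|words m| * #|words n|)%N.
Proof.
pose cut (w : {ffun 'I_(m + n) -> 'I_M}) :=
  ([ffun i => w (lshift n i)] : {ffun 'I_m -> 'I_M},
   [ffun i => w (rshift m i)] : {ffun 'I_n -> 'I_M}).
have cut_inj : injective cut.
  move=> v w [/ffunP vwl /ffunP vwr]; apply/ffunP => i.
  case: (split_ordP i) => j ->.
    by have := vwl j; rewrite !ffunE.
  by have := vwr j; rewrite !ffunE.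
rewrite -cardsX -(card_imset _ cut_inj); apply/subset_leq_card/fintype.subsetP.
move=> _ /imsetP[w + ->]; rewrite inE => /asboolP[y <-]; rewrite inE /=.
have -> : [ffun i => word (m + n) y (lshift n i)] = word m y.
  by apply/ffunP => i; rewrite !ffunE.
have -> : [ffun i => word (m + n) y (rshift m i)] = word n (iter m shift y).
  by apply/ffunP => i; rewrite !ffunE coord_iter_shift.
by rewrite !mem_words.
Qed.

Definition cylinder n (w : {ffun 'I_n -> 'I_M}) : set Y := [set y | word n y = w].

Definition symbol_cover : set (set Y) :=
  [set [set y | coord 0 y = s] | s in [set: discrete_topology 'I_M]].

Lemma symbol_cover_open : open_cover symbol_cover.
Proof.
split=> [_ [s _ <-]|]; last first.
  apply/seteqP; split=> // y _; exists [set z | coord 0 z = coord 0 y] => //.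
  by exists (coord 0 y).
have /continuousP coord_open := @coord_continuous _ B 0.
exact: (coord_open [set s] (discrete_open _)).
Qed.

(** The iterated joins of the cover also contain empty sets, one for each word
    that no point starts with. *)
Lemma cover_iter_cylinders n :
  cover_iter shift symbol_cover n `<=` range (@cylinder n) /\
  (forall y, cover_iter shift symbol_cover n (cylinder (word n y))).
Proof.
rewrite /cover_iter.
pose cyl k (w : nat -> 'I_M) : set Y :=
  [set y | forall i, (i < n)%N -> coord (k + i) y = w i].
(* Peeling off the first factor moves the others by one place, so the
   induction needs an arbitrary starting place k. *)
have cover_cyl k : \big[@cover_join Y/[set setT]]_(i < n)
    cover_preimage (iter (k + i) shift) symbol_cover = range (cyl k).
  rewrite {}/cyl; elim: n k => [|n IH] k.
    rewrite big_ord0; apply/seteqP; split=> [_ ->|_ [w _ <-]].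
      by exists (coord^~ y0) => //; apply/seteqP; split.
    by apply/seteqP; split.
  rewrite big_ord_recl; under eq_bigr do rewrite lift0 addnS -addSn.
  rewrite IH addn0; apply/seteqP; split.
    move=> _ [_ [_ [s _ <-] <-]] [_ [w _ <-] <-].
    exists (fun i => if i is i'.+1 then w i' else s) => //.
    apply/seteqP; split=> y /=.
      move=> yw; split=> [|i lt_i]; last by rewrite addSnnS yw.
      by rewrite coord_iter_shift yw.
    rewrite coord_iter_shift => -[ys yw] [_|i lt_i]; first exact: ys.
    by rewrite -addSnnS yw.
  move=> _ [w _ <-].
  exists (iter k shift @^-1` [set y | coord 0 y = w 0%N]).
    by exists [set y | coord 0 y = w 0%N] => //; exists (w 0%N).
  exists [set y | forall i, (i < n)%N -> coord (k.+1 + i) y = w i.+1].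
    by exists (w \o succn).
  apply/seteqP; split=> y /=.
    rewrite coord_iter_shift => -[ys yw] [_|i lt_i]; first exact: ys.
    by rewrite -addSnnS yw.
  move=> yw; split=> [|i lt_i]; last by rewrite addSnnS yw.
  by rewrite coord_iter_shift yw.
have -> : \big[@cover_join Y/[set setT]]_(i < n)
    cover_preimage (iter i shift) symbol_cover = range (cyl 0%N).
  exact (cover_cyl 0%N).
split=> [_ [w _ <-]|y].
  exists [ffun i : 'I_n => w i] => //; apply/seteqP; split=> y /=.
    by move=> /ffunP yw i lt_i; have := yw (Ordinal lt_i); rewrite !ffunE.
  by move=> yw; apply/ffunP => i; rewrite !ffunE -yw.
exists (coord^~ y) => //; apply/seteqP; split=> z /=.
  by move=> yw; apply/word_eq.
by move/word_eq.
Qed.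

Context {R : realType}.

(** Distinct cylinders are disjoint, so a subcover has to keep every nonempty
    one, and the nonempty ones are enough. *)
Lemma subcover_numberE n :
  subcover_number R (cover_iter shift symbol_cover n) = #|words n|%:R.
Proof.
have [sub_cyl cyl_sub] := cover_iter_cylinders n.
pose S := [set cylinder (word n y) | y in [set: Y]].
have card_S : (S #= `I_#|words n|)%card.
  have -> : S = [set cylinder (enum_val i) | i in [set: 'I_#|words n|]].
    apply/seteqP; split=> [_ [y _ <-]|_ [i _ <-]].
      exists (enum_rank_in (mem_words n y) (word n y)) => //.
      by rewrite enum_rankK_in ?mem_words.
    have := enum_valP i; rewrite inE => /asboolP[y yi].
    by exists y => //; rewrite yi.
  apply: card_eq_trans (card_esym card_II).
  apply: inj_card_eq => i j _ _ ij; apply: enum_val_inj.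
  have := enum_valP i; rewrite inE => /asboolP[y yi].
  have : cylinder (enum_val i) y by [].
  by rewrite ij => <-.
have le_S m : (exists T : set (set Y), [/\ T `<=` cover_iter shift symbol_cover n,
    (T #= `I_m)%card & \bigcup_(V in T) V = setT]) -> (#|words n| <= m)%N.
  move=> [T [T_sub card_T T_cover]]; rewrite -card_le_II.
  rewrite -(card_le_eql card_S) -(card_le_eqr card_T); apply: subset_card_le.
  move=> _ [y _ <-]; have : (\bigcup_(V in T) V) y by rewrite T_cover.
  case=> V TV; have [w _ wV] := sub_cyl _ (T_sub _ TV).
  by rewrite -wV in TV * => yw; rewrite (yw : word n y = w).
have card_words_E : [set m%:R | m in [set m : nat | exists T : set (set Y),
    [/\ T `<=` cover_iter shift symbol_cover n, (T #= `I_m)%card &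
      \bigcup_(V in T) V = setT]]] (#|words n|%:R : R).
  exists #|words n| => //; exists S; split=> // [_ [y _ <-]//|].
  by apply/seteqP; split=> // y _; exists (cylinder (word n y)) => //; exists y.
apply/le_anti/andP; split.
  apply: ge_inf => //; exists #|words n|%:R => _ [m /le_S lem <-].
  by rewrite ler_nat.
apply: lb_le_inf; first by exists #|words n|%:R.
by move=> _ [m /le_S lem <-]; rewrite ler_nat.
Qed.

Let u n : R := ln #|words n|%:R.

Lemma cover_entropy_symbol_cvg : cvgn (fun n => u n / n%:R).
Proof.
have card_pos n : #|words n|%:R \is @Num.pos R.
  by rewrite qualifE/= ltr0n card_words_gt0.
apply: subadditive_cvg => [n|m n].
  by rewrite ln_ge0// ler1n card_words_gt0.
by rewrite -lnM// ler_ln// -?natrM ?ler_nat ?card_wordsD// qualifE/= ltr0n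
  muln_gt0 !card_words_gt0.
Qed.

(** The numbers of words are submultiplicative, so the limit that defines the
    entropy of the cover exists and can be computed along the multiples of l. *)
Lemma entropy_lower_bound K l : (0 < K)%N -> (0 < l)%N ->
    (forall q, K ^ q <= #|words (l * q)|)%N ->
  ((ln (K%:R : R) / l%:R)%:E <= topological_entropy R shift)%E.
Proof.
move=> K_gt0 l_gt0 many_words; set c := _ / _.
apply: (@le_trans _ _ (cover_entropy R shift symbol_cover)%:E); last first.
  by apply: ereal_sup_ubound; exists symbol_cover => //; exact: symbol_cover_open.
rewrite lee_fin /cover_entropy.
under eq_fun do rewrite subcover_numberE.
have cvg_u := cover_entropy_symbol_cvg.
rewrite leNgt; apply/negP => lt_c.
have [n _ lt_n] := cvgr_lt _ cvg_u _ lt_c.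
have le_n : (n <= l * n.+1)%N by rewrite (leq_trans (leqnSn n))// leq_pmull.
have := lt_n _ le_n; apply/negP; rewrite -leNgt.
have lR_gt0 : 0 < l%:R :> R by rewrite ltr0n.
have K_pos : K%:R \is @Num.pos R by rewrite qualifE/= ltr0n.
rewrite ler_pdivlMr ?ltr0n ?muln_gt0 ?l_gt0// natrM mulrA divfK ?gt_eqF//.
rewrite mulr_natr -lnXn ?ltr0n// -natrX ler_ln ?ler_nat ?many_words//.
  by rewrite qualifE/= ltr0n expn_gt0 K_gt0.
by rewrite qualifE/= ltr0n card_words_gt0.
Qed.
End Entropy.

(** * Paths in the graph of an irreducible matrix *)

Definition edge (N : nat) (A : 'M[nat]_N) : rel 'I_N :=
  fun a b => A a b == 1%N.

Section Graph.
Context {N : nat} {A : 'M[nat]_N}.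
Hypothesis markovA : markov_mx A.
Local Notation X := (markov_space A).
Local Notation shift := (@markov_shift N A).

Local Notation edge := (edge A).

Lemma pow_gt0_path n a b : (0 < (A ^+ n) a b)%N ->
  exists s, [/\ path edge a s, last a s = b & size s = n].
Proof.
have [A01 _ _] := markovA.
elim: n a => [|n IH] a.
  rewrite expr0 mxE; case: eqP => [<- _|//]; by exists [::].
rewrite exprS mxE => sum_gt0.
have [c /andP[Aac Acb]] : exists c, (0 < A a c)%N && (0 < (A ^+ n) c b)%N.
  apply/existsP; rewrite -[[exists _, _]]negbK negb_exists; apply/negP => /forallP no.
  move: sum_gt0; rewrite big1// => c _; apply/eqP.
  by have := no c; rewrite -muln_gt0 lt0n negbK.
have [s [cs sb sn]] := IH c Acb; exists (c :: s); split=> //=; last by rewrite sn.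
by rewrite cs andbT /edge; case: (A01 a c) Aac => ->.
Qed.

Lemma path_exists a b :
  exists s, [/\ path edge a s, last a s = b & (0 < size s)%N].
Proof.
have [_ irrA _] := markovA; have [n n_gt0 /pow_gt0_path[s [? ? sn]]] := irrA a b.
by exists s; split; rewrite ?sn.
Qed.

Lemma successor_exists a : exists b, edge a b.
Proof.
have [s [+ _]] := path_exists a a.
by case: s => // b s /= /andP[ab _] _; exists b.
Qed.

Lemma predecessor_exists b : exists a, edge a b.
Proof.
have [s [bs sb s_gt0]] := path_exists b b.
case/lastP: s bs sb s_gt0 => // s c; rewrite rcons_path last_rcons => /andP[_ +] cb _.
by rewrite cb; exists (last b s).
Qed.

(** Otherwise the edges form the graph of a function, which is bijective because
    every vertex also has a predecessor, and A is a permutation matrix. *)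
Lemma branching_vertex :
  exists a b b', [/\ b != b', edge a b & edge a b'].
Proof.
have [A01 irrA nperm] := markovA; apply: contrapT => no_branch.
have edge_fun a b b' : edge a b -> edge a b' -> b = b'.
  move=> ab ab'; apply: contrapT => /eqP bb'; apply: no_branch.
  by exists a, b, b'.
have [pre preP] := choice predecessor_exists.
have pre_inj : injective pre.
  by move=> b b' pbb'; apply: edge_fun (preP b) _; rewrite pbb'.
have [suc sucP] := choice successor_exists.
have preK : cancel pre suc by move=> b; apply: edge_fun (sucP _) (preP _).
have sucK : cancel suc pre by exact: (canF_sym preK).
apply/negP: nperm; rewrite negbK; apply/existsP; exists (perm (can_inj sucK)).
apply/eqP/matrixP => a b; rewrite !mxE permE.
have [<-|ab] := eqVneq (suc a) b; first exact: (eqP (sucP a)).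
case: (A01 a b) => [->//|Aab]; have sab := edge_fun _ _ _ (sucP a) (introT eqP Aab).
by rewrite sab eqxx in ab.
Qed.

Lemma ray_from b : exists x : X, coord 0 x = b.
Proof.
have [suc sucP] := choice successor_exists.
have suc_ray : ray A (fun j => iter j suc b) by move=> j; apply/eqP; exact: sucP.
by exists (point_of_ray suc_ray).
Qed.

Lemma glue_finite t (x : nat -> 'I_N) (y : X) :
    (forall j, (j < t)%N -> edge (x j) (x j.+1)) -> x t = coord 0 y ->
  exists z : X,
    (forall j, (j <= t)%N -> coord j z = x j) /\ iter t shift z = y.
Proof.
move=> edge_x xty.
pose z j := if (j <= t)%N then x j else coord (j - t) y.
have z_ray : ray A z.
  move=> j; rewrite /z; have [lt_jt|lt_tj|->] := ltngtP j t.
  - by apply/eqP; exact: edge_x.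
  - by rewrite subSn 1?ltnW//; exact: (ray_coord y).
  - by rewrite xty subSnn; exact: (ray_coord y).
exists (point_of_ray z_ray); split=> [j le_jt|].
  by rewrite -[LHS]/(z j) /z le_jt.
apply: markov_space_eq => j; rewrite coord_iter_shift -[LHS]/(z _) /z.
case: leqP => [|_]; last by rewrite addKn.
by rewrite -[X in (_ <= X)%N]addn0 leq_add2l leqn0 => /eqP->; rewrite addn0.
Qed.

Lemma glue t (x y : X) : coord t x = coord 0 y ->
  exists z : X,
    (forall j, (j <= t)%N -> coord j z = coord j x) /\ iter t shift z = y.
Proof.
by apply: glue_finite => j _; apply/eqP; exact: (ray_coord x).
Qed.

Lemma simple_path a b :
  exists s, [/\ path edge a s, last a s = b & uniq (a :: s)].
Proof.
have [s [as_ sb _]] := path_exists a b.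
by case: (shortenP as_) sb => s' ? ? _ ?; exists s'.
Qed.

(** A shortest path from a to b, continued arbitrarily: it leaves a and reaches b
    only once. For a = b it has length 0. *)
Lemma taut_ray a b : exists (x : X) (t : nat),
  [/\ coord 0 x = a, coord t x = b,
      forall j, (0 < j <= t)%N -> coord j x <> a &
      forall j, (j < t)%N -> coord j x <> b].
Proof.
have [s [as_ sb uniq_s]] := simple_path a b.
have [y yb] := ray_from b.
pose x := nth a (a :: s).
have xb : x (size s) = b by rewrite /x -last_nth.
have edge_x j : (j < size s)%N -> edge (x j) (x j.+1) by move/pathP: as_; apply.
have [|z [zx _]] := @glue_finite (size s) x y edge_x; first by rewrite xb.
exists z, (size s); split; first by rewrite zx.
- by rewrite zx.
- move=> j /andP[j_gt0 le_j]; rewrite zx// => /eqP.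
  by rewrite -[X in _ == X]/(x 0%N) nth_uniq//= gtn_eqF.
- move=> j lt_j; rewrite zx 1?ltnW// -xb => /eqP.
  by rewrite nth_uniq//= ?ltn_eqF// ltnS ltnW.
Qed.

(** Let a have the successors b and b', and close up a simple path from b to a
    with the edge from a to b. If this cycle contains b', then the part of the
    path from b' to a closes up with the edge from a to b' and avoids b. *)
Lemma avoiding_cycle :
  exists (s : seq 'I_N) (u : 'I_N),
    [/\ cycle edge s, uniq s, s != [::] & u \notin s].
Proof.
have [a [b [b' [bb' ab ab']]]] := branching_vertex.
have [s [bs sa uniq_s]] := simple_path b a.
have [b's|b'Ns] := boolP (b' \in b :: s); last first.
  by exists (b :: s), b'; split; rewrite //= rcons_path bs sa.
move: b's; rewrite inE eq_sym (negPf bb') => /= b's.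
case/splitPr: b's bs sa uniq_s => s1 s2.
rewrite cat_path last_cat /= => /and3P[_ _ bs2] sa.
rewrite mem_cat cat_uniq => /andP[/norP[_ bNs2] /and3P[_ _ uniq_s2]].
by exists (b' :: s2), b; split; rewrite //= rcons_path bs2 sa.
Qed.

Lemma entering_edge (s : seq 'I_N) u t :
    path edge u t -> u \notin s -> last u t \in s ->
  exists v w, [/\ v \notin s, w \in s & edge v w].
Proof.
elim: t u => [|w t IH] u /=; first by move=> _ /negPf->.
case/andP=> uw wt uNs; have [ws _|wNs] := boolP (w \in s); last exact: IH.
by exists u, w.
Qed.

(** Take a cycle that misses some vertex u. A path from u to the cycle has a
    last vertex v before it enters the cycle, and the cycle is read from the
    point of entry. *)
Lemma avoiding_periodic_ray : exists (v : 'I_N) (c : X) (p : nat),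
  [/\ (0 < p)%N, iter p shift c = c, forall j, coord j c <> v &
      A v (coord 0 c) = 1%N].
Proof.
have [s [u [cyc_s uniq_s s0 uNs]]] := avoiding_cycle.
have [z zs] : exists z, z \in s.
  by case: s s0 {cyc_s uniq_s uNs} => // z s; exists z; rewrite mem_head.
have [t [ut tz _]] := path_exists u z.
have [|v [w [vNs ws vw]]] := entering_edge ut uNs; first by rewrite tz.
have mem_s j : iter j (next s) w \in s by elim: j => //= j; rewrite mem_next.
have c_ray : ray A (fun j => iter j (next s) w).
  by move=> j; apply/eqP; exact: (next_cycle cyc_s (mem_s j)).
have fcyc := cycle_next uniq_s.
exists v, (point_of_ray c_ray), (order (next s) w); split.
- exact: order_gt0.
- apply: markov_space_eq => j; rewrite coord_iter_shift addnC.
  rewrite -[LHS]/(iter _ (next s) w) iterD.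
  by rewrite (iter_order_cycle fcyc ws ws).
- by move=> j jv; move: vNs; rewrite -jv mem_s.
- exact/eqP.
Qed.
End Graph.

(** * Accelerating the turns of a cycle *)

Lemma ray_pow_gt0 (M : nat) (B : 'M[nat]_M) (y : markov_space B) n :
  (0 < (B ^+ n) (coord 0 y) (coord n y))%N.
Proof.
elim: n y => [|n IH] y; first by rewrite expr0 mxE eqxx.
rewrite exprS mxE (bigD1 (coord 1 y)) //= ltn_addr//.
rewrite muln_gt0 (ray_coord y 0) /=; have := IH (markov_shift y); exact.
Qed.

Section Acceleration.
Context {N : nat} {A : 'M[nat]_N}.
Hypothesis markovA : markov_mx A.
Local Notation X := (markov_space A).
Local Notation shift := (@markov_shift N A).
Context {v : 'I_N} {c : X} {p : nat}.
Hypotheses (p_gt0 : (0 < p)%N) (c_periodic : iter p shift c = c)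
  (c_avoids : forall j, coord j c <> v) (edge_vc : A v (coord 0 c) = 1%N).
Variable K : nat.

Let c_ (j : nat) : 'I_N := coord j c.

(** After v there are i full turns of c and one more symbol c_0. The extra symbol
    is what keeps the loops below from being read with one turn too many: a
    path that leaves c_0 for good may still follow c for a full turn, except
    for its last edge. *)
Definition winds (x : nat -> 'I_N) (i : nat) : bool :=
  (x 0%N == v) && [forall j : 'I_(i * p).+1, x j.+1 == c_ j].

Definition winding (x : nat -> 'I_N) : nat := \max_(i < K.+1 | winds x i) i.

Definition jump (x : nat -> 'I_N) : nat := (winding x * p).+1.

Let P := (K * p).+1.

Lemma windsP x i :
  reflect (x 0%N = v /\ forall j, (j <= i * p)%N -> x j.+1 = c_ j) (winds x i).
Proof.
apply: (iffP andP) => [[/eqP x0 /forallP xc]|[x0 xc]].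
  by split=> // j le_j; exact: (eqP (xc (Ordinal (le_j : (j < (i * p).+1)%N)))).
by split; [exact/eqP|apply/forallP => j; apply/eqP/xc; rewrite -ltnS].
Qed.

Lemma c_period i : c_ (i * p) = c_ 0.
Proof.
elim: i => [|i IH]; first by rewrite mul0n.
by rewrite mulSn -IH /c_ -coord_iter_shift c_periodic.
Qed.

Lemma winding_le x : (winding x <= K)%N.
Proof. by apply/bigmax_leqP => i _; rewrite -ltnS. Qed.

Lemma jump_le x : (jump x <= P)%N.
Proof. by rewrite ltnS leq_mul2r winding_le orbT. Qed.

Lemma jump_gt0 x : (0 < jump x)%N. Proof. by []. Qed.

Lemma jump_local x y : (forall j, (j <= P)%N -> x j = y j) -> jump x = jump y.
Proof.
move=> xy; congr (_ * p).+1; apply: eq_bigl => i.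
have le_iP : (i * p < P)%N by rewrite ltnS leq_mul2r -ltnS ltn_ord orbT.
rewrite /winds xy//; congr andb; apply: eq_forallb => j.
by rewrite xy// (leq_trans (ltn_ord j) le_iP).
Qed.

Lemma winding_gt0 x : (0 < winding x)%N -> winds x (winding x).
Proof.
apply: (big_ind (fun m => (0 < m)%N -> winds x m)) => // m n wm wn.
by rewrite /maxn; case: ifP.
Qed.

Lemma winding_eq x i : winds x i -> (i <= K)%N ->
  (forall j, (i < j <= K)%N -> ~ winds x j) -> winding x = i.
Proof.
move=> wi le_iK Nw; apply/eqP; rewrite eqn_leq; apply/andP; split.
  apply/bigmax_leqP => j wj; rewrite leqNgt; apply/negP => lt_ij.
  by apply: (Nw j) => //; rewrite lt_ij -ltnS ltn_ord.
pose o : 'I_K.+1 := Ordinal (le_iK : (i < K.+1)%N).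
exact: (@leq_bigmax_cond _ _ (fun i : 'I_K.+1 => nat_of_ord i) o).
Qed.

Lemma jump1 x : x 0%N <> v \/ x 1%N <> c_ 0 -> jump x = 1%N.
Proof.
move=> x01; rewrite /jump.
have [->//|/winding_gt0/windsP[x0 xc]] := posnP (winding x).
by case: x01; rewrite ?xc ?x0.
Qed.

Lemma jump_over x j : (0 < j < jump x)%N -> x j <> v.
Proof.
case: j => // j /=; rewrite ltnS => lt_j.
have : (0 < winding x)%N by case: (winding x) lt_j.
by move=> /winding_gt0/windsP[_ xc]; rewrite xc 1?ltnW//; exact: c_avoids.
Qed.

Local Notation leap := (@leap N A jump).
Local Notation jump_at := (@jump_at N A jump).
Local Notation state_of := (@state_of N A P).
Local Notation B := (recoding A P jump).

Lemma leap1 x : coord 0 x <> v \/ coord 1 x <> c_ 0 -> leap x = shift x.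
Proof. by move=> x01; rewrite /leap /jump_at jump1. Qed.

Lemma iter_leap1 x t :
    (forall j, (j < t)%N -> coord j x <> v \/ coord j.+1 x <> c_ 0) ->
  iter t leap x = iter t shift x.
Proof.
elim: t => // t IH xt; rewrite iterS IH => [|j lt_j]; last first.
  by apply: xt; rewrite ltnW.
by rewrite leap1 ?coord_iter_shift ?addn0 ?addn1//; exact: xt.
Qed.

(** Leaps do not jump over v. *)
Lemma leap_hits x t : coord t x = v -> exists k, iter k leap x = iter t shift x.
Proof.
elim/ltn_ind: t x => -[|t] IH x xv; first by exists 0%N.
have le_jump : (jump_at x <= t.+1)%N.
  by rewrite leqNgt; apply/negP => lt_t; apply: (@jump_over (coord^~ x) t.+1).
have [||k kx] := IH (t.+1 - jump_at x)%N _ (leap x).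
- by rewrite ltn_subrL jump_gt0.
- by rewrite coord_iter_shift subnKC.
by exists k.+1; rewrite iterSr kx -iterD subnK.
Qed.

Lemma acceleration_orbit_equivalent : continuously_orbit_equivalent A B.
Proof.
apply: recoding_orbit_equivalent => [x y|x|x|x j /andP[j_gt0 lt_j]].
- exact: jump_local.
- exact: jump_gt0.
- exact: jump_le.
- apply: jump1; left; rewrite coord_iter_shift addn0.
  by apply: (@jump_over (coord^~ x)); rewrite j_gt0.
Qed.

(** Follow a point in the state s up to v, make K turns of c, go from c_0 to the
    first symbol of t along a taut path, and continue with a point in the
    state t. The orbit meets the visit to v; as K is the largest number of
    turns that one leap can make, it jumps from there exactly to the end of the
    K turns; and on the taut path, which does not return to c_0, leaps are
    shifts. *)
Lemma acceleration_reaches s t :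
  exists n x, [/\ (0 < n)%N, state_of x = s & state_of (iter n leap x) = t].
Proof.
have [xs <-] := state_ofP s; have [xt <-] := state_ofP t.
(* The point is built backwards, from its end xt to its beginning xs. *)
have [w [m [w0 wm w_no _]]] := taut_ray markovA (c_ 0) (coord 0 xt).
have [y3 [y3w y3t]] := glue wm.
have [|y2 [y2c y2_y3]] := @glue _ _ (K * p) c y3.
  by rewrite y3w// w0; exact: c_period.
pose vc j := if j is 0 then v else c_ 0.
have [[]//= _||y1 [y1vc y1_y2]] := @glue_finite _ A 1 vc y2.
- exact/eqP.
- by rewrite /= y2c.
have [u [l [u0 ul _ _]]] := taut_ray markovA (coord P xs) v.
have [|y0 [y0u y0_y1]] := @glue _ _ l u y1; first by rewrite ul y1vc.
have [|y [ys y_y0]] := @glue _ _ P xs y0; first by rewrite y0u.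
have y_y1 : iter (l + P) shift y = y1 by rewrite iterD y_y0.
have [k ky] : exists k, iter k leap y = y1.
  rewrite -y_y1; apply: leap_hits.
  by rewrite -[(l + P)%N]addn0 -coord_iter_shift y_y1 y1vc.
have wind_y1 : winding (coord^~ y1) = K.
  apply: winding_eq => //; last by move=> j /andP[/leq_trans/[apply]]; rewrite ltnn.
  apply/windsP; split; first by rewrite y1vc.
  by move=> j le_j; rewrite -[RHS]/(coord j c) -y2c// -y1_y2 coord_iter_shift.
have leap_y1 : leap y1 = y3.
  by rewrite /leap /jump_at /jump wind_y1 iterSr -y2_y3 -y1_y2.
have leap_y3 : iter m leap y3 = xt.
  rewrite iter_leap1// => j lt_j; right; rewrite y3w//.
  exact: w_no.
exists (m + k.+1)%N, y; split; first by rewrite addnS.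
  by apply/state_of_eq => j; exact: ys.
by rewrite iterD iterS ky leap_y1 leap_y3.
Qed.

(** In the shift of a permutation matrix a point is determined by its first
    symbol. But c and a ray that follows c for a long time before it goes to v
    have the same first window. *)
Lemma acceleration_not_perm : ~~ is_perm_mx B.
Proof.
apply/negP => /existsP[s /eqP Bs].
have [q [l [q0 ql _ _]]] := taut_ray markovA (c_ 0) v.
have [|x [xc x_q]] := @glue _ _ (P * p) c q; first by rewrite q0; exact: c_period.
have code_det z n : coord n (code jump_local z) = iter n s (state_of z).
  elim: n => //= n <-; have := ray_coord (code jump_local z) n.
  by rewrite {1}Bs !mxE; case: eqP.
have xc_state : state_of x = state_of c.
  apply/state_of_eq => j le_j; apply: xc.
  by rewrite (leq_trans le_j)// leq_pmulr.
have x_eq_c : x = c.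
  apply: (can_inj (codeK jump_local jump_gt0 jump_le)).
  by apply: markov_space_eq => n; rewrite !code_det xc_state.
apply: (@c_avoids (P * p + l)%N).
by rewrite -{1}x_eq_c -coord_iter_shift x_q.
Qed.

Lemma acceleration_markov : markov_mx B.
Proof.
split; last exact: acceleration_not_perm.
  by move=> s t; rewrite mxE; case: [forall j, _]; [right|left].
move=> s t; have [n [x [n_gt0 <- <-]]] := acceleration_reaches s t.
exists n => //; exact: (ray_pow_gt0 (code jump_local x) n).
Qed.

Section Loops.
Context {q : X} {l : nat}.
Hypotheses (q0 : coord 0 q = c_ 0) (ql : coord l q = v)
  (q_leaves : forall j, (0 < j <= l)%N -> coord j q <> c_ 0)
  (q_avoids : forall j, (j < l)%N -> coord j q <> v).

(** The closed path v c^i q, with its final vertex v at j = i * p + l + 1. *)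
Definition loop (i j : nat) : 'I_N :=
  if j is j'.+1 then
    if (j' < i * p)%N then c_ j' else coord (j' - i * p) q
  else v.

Arguments loop : simpl never.

Definition loop_length (i : nat) := (i * p + l).+1.

Lemma loop_q i j : loop i (i * p + j).+1 = coord j q.
Proof. by rewrite /loop ltnNge leq_addr addKn. Qed.

Lemma loop_c i j : (j <= i * p)%N -> loop i j.+1 = c_ j.
Proof.
rewrite leq_eqVlt => /predU1P[->|]; last by rewrite /loop => ->.
by rewrite -[in loop _ _](addn0 (i * p)%N) loop_q q0 c_period.
Qed.

Lemma loop_ray (a : nat -> nat) :
  ray A (splice (loop_length \o a) (loop \o a)).
Proof.
rewrite /ray; apply: (splice_rel (e := fun x y => A x y = 1%N)) => // [k i|k].
  rewrite /= /loop_length; move: (a k) => m; case: i => [_|i lt_i].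
    by rewrite (@loop_c m 0).
  have [lt_im|le_mi] := ltnP i (m * p).
    rewrite (loop_c (ltnW lt_im)) (@loop_c m i.+1 lt_im).
    exact: (ray_coord c).
  rewrite -(subnKC le_mi); move: (i - m * p)%N => d.
  rewrite loop_q -addnS loop_q; exact: (ray_coord q).
by rewrite /= loop_q.
Qed.

Definition loops (a : nat -> nat) : X := point_of_ray (loop_ray a).

Lemma loops_next a :
  iter (loop_length (a 0)) shift (loops a) = loops (a \o succn).
Proof.
apply: markov_space_eq => j; rewrite coord_iter_shift.
exact: (@splice_behead _ (loop_length \o a)).
Qed.

Lemma coord_loops a j : (j <= loop_length (a 0))%N ->
  coord j (loops a) = loop (a 0%N) j.
Proof.
rewrite leq_eqVlt => /predU1P[->|lt_j].
  rewrite -[X in coord X _]addn0 -coord_iter_shift loops_next /loop_length loop_q ql.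
  exact: splice_head.
exact: splice_head.
Qed.

(** One more turn of c after v c^i would force q to visit c_0 a second time if
    p <= l, and c to visit v if l < p. *)
Lemma winding_loops a : (a 0 <= K)%N -> winding (coord^~ (loops a)) = a 0%N.
Proof.
move=> le_aK; apply: winding_eq => // [|i /andP[lt_ai le_iK] /windsP[_ xc]].
  apply/windsP; split; first by rewrite coord_loops.
  by move=> j le_j; rewrite coord_loops ?loop_c// ltnS (leq_trans le_j)// leq_addr.
have le_ai : (a 0 * p + p <= i * p)%N by rewrite addnC -mulSn leq_mul2r lt_ai orbT.
have [le_pl|lt_lp] := leqP p l.
  apply: (@q_leaves p); first by rewrite p_gt0.
  rewrite -(c_period (a 0).+1) mulSn addnC -xc//.
  by rewrite coord_loops ?loop_q// ltnS leq_add2l.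
apply: (@c_avoids (a 0 * p + l)%N).
rewrite -[LHS]xc; last by rewrite (leq_trans _ le_ai)// leq_add2l ltnW.
by rewrite coord_loops ?loop_q.
Qed.

(** One leap makes all the turns of c, and then l shifts run along q, whose
    vertices before the last one differ from v. *)
Lemma leap_loops a : (a 0 <= K)%N ->
  iter l.+1 leap (loops a) = loops (a \o succn).
Proof.
move=> le_aK; rewrite iterSr.
have -> : leap (loops a) = iter (a 0 * p).+1 shift (loops a).
  by rewrite /leap /jump_at /jump winding_loops.
rewrite iter_leap1 => [|j lt_j].
  by rewrite -iterD -loops_next /loop_length addnS addnC.
left; rewrite coord_iter_shift addSn coord_loops.
  by rewrite loop_q; exact: q_avoids.
by rewrite ltnS leq_add2l ltnW.
Qed.

Lemma iter_leap_loops a i : (forall k, (a k <= K)%N) ->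
  iter (l.+1 * i) leap (loops a) = loops (fun k => a (i + k)%N).
Proof.
move=> aK; elim: i => [|i IH]; first by rewrite muln0.
rewrite mulnS iterD IH leap_loops//; congr loops; apply/funext => k /=.
by rewrite addnS addSn.
Qed.

(** The number of turns in each loop can be read off from the state at the
    beginning of the loop, since it determines the length of the leap. *)
Lemma many_words n : (K.+1 ^ n <= #|@words _ B (l.+1 * n)|)%N.
Proof.
pose ext (a : {ffun 'I_n -> 'I_K.+1}) k : nat :=
  oapp (fun i => nat_of_ord (a i)) 0%N (insub k).
have extK a k : (ext a k <= K)%N.
  by rewrite /ext; case: insub => //= i; rewrite -ltnS.
pose w a := word (l.+1 * n) (code jump_local (loops (ext a))).
have w_inj : injective w.
  move=> a b /word_eq ab; apply/ffunP => i; apply/val_inj.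
  have lt_i : (l.+1 * i < l.+1 * n)%N by rewrite ltn_pmul2l.
  have : state_of (loops (fun k => ext a (i + k)%N)) =
         state_of (loops (fun k => ext b (i + k)%N)).
    by rewrite -!iter_leap_loops//; exact: ab.
  move/(congr1 (fun s => jump (symbol s))).
  rewrite !(jump_state_of jump_local) /jump_at /jump !winding_loops//.
  move=> [/eqP]; rewrite eqn_pmul2r// !addn0 /ext !valK => /eqP.
  exact.
have <- : #|{: {ffun 'I_n -> 'I_K.+1}}| = (K.+1 ^ n)%N.
  by rewrite card_ffun !card_ord.
rewrite -(card_imset _ w_inj).
apply/subset_leq_card/fintype.subsetP => _ /imsetP[a _ ->].
exact: mem_words.
Qed.
End Loops.
End Acceleration.

(** * Shifts of arbitrarily large entropy *)

Theorem theorem2p5 (R : realType) (N : nat) (A : 'M[nat]_N)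
    (markovA : markov_mx A) (r : R) (r_gt0 : 0 < r) :
  exists (M : nat) (B : 'M[nat]_M),
    [/\ markov_mx B,
        continuously_orbit_equivalent A B &
        (r%:E < topological_entropy R (@markov_shift M B))%E].
Proof.
have [v [c [p [p_gt0 c_periodic c_avoids edge_vc]]]] :=
  avoiding_periodic_ray markovA.
have [q [l [q0 ql q_leaves q_avoids]]] := taut_ray markovA (coord 0 c) v.
(* Large enough for ln (K + 1) / (l + 1) to exceed r. *)
pose K := Num.truncn (expR (r * l.+1%:R)).
exists _, (recoding A (K * p).+1 (@jump _ _ v c p K)); split.
- exact: acceleration_markov.
- exact: acceleration_orbit_equivalent.
- apply: lt_le_trans (entropy_lower_bound (K := K.+1) (l := l.+1) _ _ _ _) => //.
  + rewrite lte_fin ltr_pdivlMr// -ltr_expR lnK ?qualifE//=.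
    exact: truncnS_gt.
  + exact: (code (@jump_local _ _ v c p K) c).
  + exact: (many_words p_gt0 c_periodic c_avoids edge_vc K q0 ql q_leaves
      q_avoids).
Qed.
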